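(* Let $n$ be an odd positive integer and let $G_n$ be the unitary addition Cayley graph on $\mathbb{Z}_n$. Then $$\phi(G_n) = \big(x - \varphi(n)\big) \prod_{r=1}^{\lfloor \frac{n-1}{2} \rfloor} \big(x^2 - \lambda_r^2\big) + \sum_{i \in U(n)} \phi\big(X(A_n) - \{ l_j : j \in U(n),\ j < i \} - i\big),$$ where $\varphi$ is Euler's totient function, $\lambda_r = \sum_{0 \le j \le n-1,\ \gcd(j,n)=1} w^{rj}$ with $w = e^{2\pi\sqrt{-1}/n}$, and $l_j$ denotes the loop of $X(A_n)$ at vertex $j$.
   Context: $U(n)$ is the set of units of the ring $\mathbb{Z}_n=\{0,1,\dots,n-1\}$, its elements being regarded as integers in $\{0,\dots,n-1\}$ with their usual order. The unitary addition Cayley graph $G_n$ is the simple graph (no loops) with vertex set $\mathbb{Z}_n$ in which two distinct vertices $a,b$ are adjacent if and only if $a+b \in U(n)$. The matrix $A_n$ is the $n\times n$ anti-circulant matrix whose rows and columns are indexed by $0,1,\dots,n-1$ and whose $(a,b)$ entry is $1$ if $\gcd(a+b,n)=1$ and $0$ otherwise. $X(A_n)$ is the graph, possibly with loops, on vertex set $\{0,1,\dots,n-1\}$ whose adjacency matrix is $A_n$ (a diagonal entry $1$ means a loop at that vertex); for $n$ odd its loops are exactly at the vertices $j\in U(n)$. For a graph $G$, possibly with loops, $\phi(G)=\det(xI-A(G))$ is the characteristic polynomial of its adjacency matrix; for the graph with no vertices it equals $1$. Deleting a set of loops keeps all vertices; deleting a vertex $i$, written $-i$, removes $i$ and all edges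 and loops incident to it. Euler's totient function is written $\varphi$ here to distinguish it from the characteristic polynomial $\phi$. *)

(* Defs.v *)
From mathcomp Require Import all_boot all_order all_algebra.
From mathcomp Require Import reals sequences exp trigo complex.

Set Implicit Arguments.
Unset Strict Implicit.
Unset Printing Implicit Defensive.

Import Order.TTheory GRing.Theory Num.Theory.
Local Open Scope ring_scope.

(* Graphs, possibly with loops: [adj G x x] means that G has a loop at x.
   The vertex set is a subset of an ambient type T, so that vertices can be
   deleted without changing T. *)
Record lgraph (T : finType) := LGraph {
  vset : {set T};
  adj : rel T;
  adj_sym : symmetric adj;
  adj_vset : forall x y, adj x y -> x \in vset
}.

Section Graphs.
Variable T : finType.
Implicit Types (G : lgraph T) (L : {set T}).

Definition adj_mx (C : nzRingType) G : 'M[C]_#|vset G| :=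
  \matrix_(i, j) (adj G (enum_val i) (enum_val j))%:R.

Definition graph_char_poly (C : nzRingType) G : {poly C} :=
  char_poly (adj_mx C G).

Section DelLoops.
Variables (G : lgraph T) (L : {set T}).

Definition del_loops_adj : rel T :=
  fun x y => adj G x y && ~~ ((x == y) && (x \in L)).

Lemma del_loops_sym : symmetric del_loops_adj.
Proof.
move=> x y; rewrite /del_loops_adj adj_sym [y == x]eq_sym.
by case: eqP => // ->.
Qed.

Lemma del_loops_vset x y : del_loops_adj x y -> x \in vset G.
Proof. by case/andP => /adj_vset. Qed.

Definition del_loops : lgraph T := LGraph del_loops_sym del_loops_vset.

End DelLoops.

Section DelVertex.
Variables (G : lgraph T) (v : T).

Definition del_vertex_adj : rel T :=
  fun x y => [&& adj G x y, x != v & y != v].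

Lemma del_vertex_sym : symmetric del_vertex_adj.
Proof. by move=> x y; rewrite /del_vertex_adj adj_sym [(x != v) && _]andbC. Qed.

Lemma del_vertex_vset x y : del_vertex_adj x y -> x \in vset G :\ v.
Proof. by case/and3P => /adj_vset xG xv _; rewrite !inE xv. Qed.

Definition del_vertex : lgraph T := LGraph del_vertex_sym del_vertex_vset.

End DelVertex.

End Graphs.

(* The ring Z_n is 'I_n with the operations Zp_add and Zp_mul; unlike the
   canonical ring 'Z_n, this is also right for n = 1, where 0 is a unit. *)
Definition U (n : nat) : {set 'I_n} :=
  [set a | [exists b : 'I_n, val (Zp_mul a b) == (1 %% n)%N]].

Section UnitaryAddition.
Variable n : nat.

Definition unitary_addition_adj : rel 'I_n :=
  fun a b => (a != b) && (Zp_add a b \in U n).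

Lemma unitary_addition_sym : symmetric unitary_addition_adj.
Proof. by move=> a b; rewrite /unitary_addition_adj eq_sym Zp_addC. Qed.

Definition unitary_addition_Cayley_graph : lgraph 'I_n :=
  @LGraph _ [set: 'I_n] _ unitary_addition_sym (fun a _ _ => in_setT a).

Definition A_mx : 'M[nat]_n :=
  \matrix_(a < n, b < n) (if gcdn (a + b) n == 1%N then 1%N else 0%N).

Lemma A_mx_sym a b : A_mx a b = A_mx b a.
Proof. by rewrite !mxE addnC. Qed.

End UnitaryAddition.

Section MatrixGraph.
Variables (n : nat) (A : 'M[nat]_n) (symA : forall a b, A a b = A b a).

(* The graph with adjacency matrix A, for a symmetric 0-1 matrix A. *)
Definition mx_adj : rel 'I_n := fun a b => A a b == 1%N.

Lemma mx_adj_sym : symmetric mx_adj.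
Proof. by move=> a b; rewrite /mx_adj symA. Qed.

Definition mx_graph : lgraph 'I_n :=
  @LGraph _ [set: 'I_n] _ mx_adj_sym (fun a _ _ => in_setT a).

End MatrixGraph.

Definition X_A (n : nat) : lgraph 'I_n := mx_graph (@A_mx_sym n).

Lemma unit_coprime (n : nat) (a : 'I_n) : (a \in U n) = coprime a n.
Proof.
case: n a => [[]//|n] a; rewrite inE; apply/existsP/idP => [[b /eqP]|].
  rewrite /= => ab1; have: coprime (a * b) n.+1.
    by rewrite -coprime_modl ab1 coprime_modl coprime1n.
  by rewrite coprimeMl => /andP[].
rewrite coprime_sym => /Zp_mulzV aV1.
by exists (Zp_inv a); rewrite aV1.
Qed.

Lemma X_A_loop (n : nat) (j : 'I_n) : odd n -> adj (X_A n) j j = (j \in U n).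
Proof.
move=> n_odd; rewrite unit_coprime /= /mx_adj mxE addnn -mul2n.
rewrite -[gcdn _ _ == _]/(coprime _ _) coprimeMl coprime2n n_odd.
by case: coprime.
Qed.

Section Eigenvalues.
Variable R : realType.
Local Open Scope complex_scope.

Definition cexp (z : R[i]) : R[i] :=
  (expR (complex.Re z))%:C * (cos (complex.Im z) +i* sin (complex.Im z)).

Definition w (n : nat) : R[i] := cexp ((2 * pi)%:C * 'i / n%:R).

Lemma wE (n : nat) : w n = cos (2 * pi / n%:R) +i* sin (2 * pi / n%:R).
Proof.
rewrite /w -(rmorph_nat (real_complex R)) -fmorphV mulrAC -rmorphM.
by rewrite /cexp; simpc => /=; rewrite expR0 mul1r; simpc.
Qed.

Definition lambda (n r : nat) : R[i] :=
  \sum_(0 <= j < n | gcdn j n == 1%N) w n ^+ (r * j).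

End Eigenvalues.

(* Main.v *)
(* Expanding the determinant along row i shows that deleting a loop at i adds
   phi(X - i) to phi(X); deleting the loops of X(A_n) one by one, in increasing
   order, turns X(A_n) into G_n and yields the sum over U(n).

   The matrix A_n maps the character w^(k b) to lambda_k w^(- k a), and
   lambda is even, so w^(k a) + w^(- k a) and w^(k a) - w^(- k a) are
   eigenvectors with eigenvalues lambda_k and - lambda_k. As n is odd, taking
   one of each kind for every pair {k, - k} with k <> 0, together with the
   constant 1, gives a basis. *)

Require Import Defs.
From mathcomp Require Import all_boot all_order all_algebra fingroup perm.
From mathcomp Require Import reals complex exp trigo.
From mathcomp Require Import ring lra zify.
Import Order.TTheory GRing.Theory Num.Theory.
Local Open Scope ring_scope.
Local Open Scope complex_scope.

Set Implicit Arguments.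
Unset Strict Implicit.
Unset Printing Implicit Defensive.

(** Two injective enumerations of one set differ by a permutation [s], which acts on rows and
    columns alike, so its sign enters squared. *)
Lemma det_reindex (R : comNzRingType) (T : finType) (B : T -> T -> R)
    (p q : nat) (f : 'I_p -> T) (g : 'I_q -> T) :
  injective f -> injective g -> codom f =i codom g ->
  \det (\matrix_(i, j) B (f i) (f j)) = \det (\matrix_(i, j) B (g i) (g j)).
Proof.
move=> f_inj g_inj fg.
have pq : p = q.
  rewrite -[p]card_ord -[q]card_ord -(card_codom f_inj) -(card_codom g_inj).
  exact: eq_card.
subst q.
have fP i : f i \in codom g by rewrite -fg codom_f.
pose h i := iinv (fP i).
have hK i : g (h i) = f i by rewrite f_iinv.
have h_inj : injective h by move=> i j hij; apply: f_inj; rewrite -!hK hij.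
pose s := perm h_inj.
have -> : \matrix_(i, j) B (f i) (f j) =
    row_perm s (col_perm s (\matrix_(i, j) B (g i) (g j))).
  by apply/matrixP=> i j; rewrite !mxE !permE !hK.
rewrite row_permE col_permE !det_mulmx !det_perm odd_permV mulrCA -expr2.
by rewrite sqrr_sign mulr1.
Qed.

Lemma codom_enum_val (T : finType) (A : {pred T}) :
  codom (@enum_val T (mem A)) =i A.
Proof.
move=> x; apply/codomP/idP => [[i ->]|xA]; first exact: enum_valP.
by exists (enum_rank_in xA x); rewrite enum_rankK_in.
Qed.

(** * Characteristic polynomials of graphs and deletion of loops *)

Section GraphCharPoly.
Variables (C : comNzRingType) (T : finType).
Implicit Type G : lgraph T.

(** Frees the polynomial from [enum_val], so that each argument can pick a convenient enumeration of
    the vertices. *)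
Lemma graph_char_polyE G (m : nat) (f : 'I_m -> T) :
  injective f -> codom f =i vset G ->
  graph_char_poly C G =
  \det (\matrix_(i, j) ('X *+ (f i == f j) - (adj G (f i) (f j))%:R%:P)).
Proof.
move=> f_inj fG.
rewrite -(det_reindex (fun x y => 'X *+ (x == y) - (adj G x y)%:R%:P)
  (@enum_val_inj _ (mem (vset G))) f_inj).
  congr (\det _); apply/matrixP=> i j.
  by rewrite !mxE (inj_eq enum_val_inj).
by move=> x; rewrite fG codom_enum_val.
Qed.

Lemma eq_graph_char_poly G1 G2 :
  vset G1 = vset G2 -> adj G1 =2 adj G2 ->
  graph_char_poly C G1 = graph_char_poly C G2.
Proof.
move=> V12 A12.
have f_inj := @enum_val_inj _ (mem (vset G1)).
have fG := codom_enum_val (vset G1).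
rewrite (graph_char_polyE f_inj fG) (graph_char_polyE f_inj (G := G2)) -?V12 //.
by congr (\det _); apply/matrixP=> i j; rewrite !mxE A12.
Qed.

Lemma graph_char_poly_del_loop G (v : T) :
  adj G v v ->
  graph_char_poly C (del_loops G [set v]) =
  graph_char_poly C G + graph_char_poly C (del_vertex G v).
Proof.
move=> Gvv; have vG := adj_vset Gvv.
(* Writing the order as a successor lets [lift k] enumerate the vertices other than [v]. *)
have [m Vm] : exists m, m.+1 = #|vset G|.
  by exists #|vset G|.-1; rewrite prednK //; apply/card_gt0P; exists v.
pose f (i : 'I_m.+1) : T := enum_val (cast_ord Vm i).
have f_inj : injective f by move=> i j /enum_val_inj/cast_ord_inj.
have fG : codom f =i vset G.
  move=> x; apply/codomP/idP => [[i ->]|xG]; first exact: enum_valP.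
  exists (cast_ord (esym Vm) (enum_rank_in xG x)).
  by rewrite /f cast_ordKV enum_rankK_in.
have /codomP[k vk] : v \in codom f by rewrite fG.
have fk_inj : injective (f \o lift k) by apply: inj_comp => //; apply: lift_inj.
have fkG : codom (f \o lift k) =i vset (del_vertex G v).
  move=> x; rewrite !inE -fG; apply/codomP/andP => [[i ->]|[xv /codomP[i xi]]].
    by rewrite /= codom_f vk (inj_eq f_inj) eq_sym neq_lift.
  have [j ij|ik] := unliftP k i; first by exists j; rewrite /= -ij.
  by rewrite xi ik vk eqxx in xv.
rewrite (graph_char_polyE (G := del_loops G [set v]) f_inj fG).
rewrite (graph_char_polyE (G := G) f_inj fG) (graph_char_polyE fk_inj fkG).
set M1 := (X in \det X = _); set M := (X in _ = \det X + _).
set M0 := (X in _ = _ + \det X).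
(* Only the diagonal entry at [k] changes, so the cofactors along row [k] agree, and the extra 1
   contributes the cofactor at [(k, k)]. *)
have M1E : M1 = M + delta_mx k k.
  apply/matrixP=> i j; rewrite !mxE /= /del_loops_adj !inE vk !(inj_eq f_inj).
  case: (eqVneq i k) => [->|ik] /=; last by rewrite andbF andbT addr0.
  rewrite [k == j]eq_sym; case: (eqVneq j k) => [->|] /=.
    by rewrite -vk Gvv /= subrK subr0.
  by rewrite andbT addr0.
have coM i : cofactor M1 k i = cofactor M k i.
  rewrite /cofactor; congr (_ * \det _); apply/matrixP=> a b.
  by rewrite M1E !mxE [lift k a == k]eq_sym (negPf (neq_lift _ _)) addr0.
have coM0 : cofactor M k k = \det M0.
  rewrite /cofactor addnn -mul2n exprM sqrrN expr1n expr1n mul1r.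
  congr (\det _); apply/matrixP=> a b; rewrite !mxE /= /del_vertex_adj vk.
  by rewrite !(inj_eq f_inj) ![lift k _ == k]eq_sym !neq_lift !andbT.
rewrite (expand_det_row M1 k) (expand_det_row M k) -coM0.
rewrite (bigD1 k) //= [in RHS](bigD1 k) //= coM M1E !mxE !eqxx mulrDl mul1r.
rewrite addrAC; congr (_ + _ + _); apply: eq_bigr => j jk.
by rewrite -M1E coM M1E !mxE (negPf jk) andbF addr0.
Qed.

End GraphCharPoly.

Lemma graph_char_poly_del_loops (C : comNzRingType) (n : nat)
    (G : lgraph 'I_n) (S : {set 'I_n}) :
  (forall i, i \in S -> adj G i i) ->
  graph_char_poly C (del_loops G S) = graph_char_poly C G +
  \sum_(i in S) graph_char_poly C
    (del_vertex (del_loops G [set j in S | (j < i)%N]) i).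
Proof.
move=> GS; pose L (k : nat) := [set j in S | (j < k)%N].
pose F k := graph_char_poly C (del_loops G (L k)).
have -> : graph_char_poly C (del_loops G S) = F n.
  apply: eq_graph_char_poly => // x y.
  by rewrite /= /del_loops_adj /L !inE ltn_ord andbT.
have -> : graph_char_poly C G = F 0%N.
  apply: eq_graph_char_poly => // x y.
  by rewrite /= /del_loops_adj /L !inE ltn0 !andbF andbT.
(* The difference telescopes along [F]; passing from [i] to [i.+1] deletes a loop only if [i] is in
   [S]. *)
apply/eqP; rewrite addrC -subr_eq -(telescope_sumr F (leq0n n)) big_mkord.
apply/eqP; rewrite [RHS]big_mkcond /=; apply: eq_bigr => i _.
apply/eqP; rewrite subr_eq addrC; apply/eqP.
case: ifP => iS.
  rewrite -graph_char_poly_del_loop; last first.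
    by rewrite /= /del_loops_adj GS // !inE ltnn !andbF.
  apply: eq_graph_char_poly => // x y.
  rewrite /= /del_loops_adj /= /del_loops_adj !inE -andbA ltnS leq_eqVlt.
  congr (_ && _); case: (eqVneq x i) => [->|xi].
    by rewrite eqxx ltnn iS; case: (i == y).
  by rewrite [_ == _ :> nat](negPf xi) !andbF !andbT.
rewrite addr0; apply: eq_graph_char_poly => // x y.
rewrite /= /del_loops_adj /L !inE ltnS leq_eqVlt.
case: (eqVneq x i) => [->|xi]; first by rewrite iS.
by rewrite [_ == _ :> nat](negPf xi).
Qed.

(** * Spectrum of an anti-circulant matrix of odd order with even symbol *)

Section AntiCirculant.
Variables (C : numFieldType) (N : nat) (z : C).
Hypotheses (zP : N.+1.-primitive_root z) (N_even : ~~ odd N).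
Variable c : 'I_N.+1 -> C.
Hypothesis cN : forall j, c (- j) = c j.
Implicit Types a b k : 'I_N.+1.

(** The discrete Fourier transform of [c]; it becomes [lambda] when [c] is the indicator of the
    units. *)
Definition char_sum (r : nat) : C := \sum_(j < N.+1) c j * z ^+ (r * j).

Let chi k a : C := z ^+ (k * a).

Let chiD k a b : chi k (a + b) = chi k a * chi k b.
Proof.
by rewrite /chi -exprD -mulnDr -(prim_expr_mod zP) modnMmr (prim_expr_mod zP).
Qed.

Let chiC k a : chi k a = chi a k.
Proof. by rewrite /chi mulnC. Qed.

Let chiN k a : chi k (- a) = chi a (- k).
Proof.
have chi0 : chi k a != 0.
  by apply: contraTneq isT => /eqP; rewrite expf_eq0 (prim_root_eq0 zP) andbF.
(* Both sides are inverse to [chi k a]. *)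
apply: (mulIf chi0) => /=; rewrite -chiD [chi k a]chiC -chiD !addNr.
by rewrite /chi !muln0.
Qed.

Let char_sum_opp k : \sum_j c j * chi k (- j) = char_sum k.
Proof.
rewrite (reindex_inj oppr_inj) /=.
by apply: eq_bigr => j _; rewrite cN opprK.
Qed.

Lemma char_sum_sub (r : nat) :
  (r <= N.+1)%N -> char_sum (N.+1 - r) = char_sum r.
Proof.
move=> rN; rewrite /char_sum (reindex_inj oppr_inj) /=; apply: eq_bigr => j _.
rewrite cN; congr (_ * _); apply/eqP; rewrite (eq_prim_root_expr zP) /= modnMmr.
(* Adding a multiple of [N.+1] to the exponent gives an identity free of negative terms in [nat]. *)
rewrite -(modnMDl (r + j)); apply/eqP.
have -> : ((r + j) * N.+1 + (N.+1 - r) * (N.+1 - j) = N.+1 * N.+1 + r * j)%N.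
  by have := ltn_ord j; nia.
by rewrite modnMDl.
Qed.

(* With this sign, column k of V below is an even (k <= N/2) or odd (k > N/2)
   function on Z_n, and A multiplies it by char_sum k, resp. - char_sum k. *)
Let s k : C := if k == 0 then 0 else if (k <= N./2)%N then 1 else -1.

(** Oddness of the order enters here: for nonzero [k], exactly one of [k] and [- k] is at most
    [N./2]. *)
Let sN k : s (- k) = - s k.
Proof.
rewrite /s oppr_eq0; case: eqVneq => [|k0]; first by rewrite oppr0.
have kgt0 : (0 < k)%N.
  by rewrite lt0n; apply: contra k0 => /eqP k0; apply/eqP/val_inj.
have -> : val (- k) = (N.+1 - k)%N :> nat.
  by rewrite /= modn_small //; have := ltn_ord k; lia.
have kN := ltn_ord k; have := odd_double_half N; rewrite (negPf N_even).
rewrite add0n => NE.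
case: (leqP k); case: (leqP (N.+1 - k)) => ? ?; rewrite ?opprK //; exfalso; lia.
Qed.

Let A := \matrix_(a, b < N.+1) c (a + b).
Let d k : C := if (k <= N./2)%N then char_sum k else - char_sum k.
Let V := \matrix_(a, k < N.+1) (chi k a + s k * chi k (- a)).

Let AV : A *m V = V *m diag_mx (\row_k d k).
Proof.
apply/matrixP=> a k; rewrite mul_mx_diag !mxE.
have sum_shift (f : 'I_N.+1 -> C) :
    \sum_b c (a + b) * f b = \sum_j c j * f (j - a).
  rewrite (reindex_inj (addIr (- a))) /=.
  by apply: eq_bigr => j _; rewrite addrC subrK.
under eq_bigr => b _ do rewrite !mxE.
rewrite (sum_shift (fun b => chi k b + s k * chi k (- b))).
under eq_bigr => j _ do rewrite opprB addrC !chiD mulrDr.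
rewrite big_split /=.
have -> : \sum_j c j * (s k * (chi k a * chi k (- j))) =
    char_sum k * (s k * chi k a).
  by rewrite -[in RHS]char_sum_opp mulr_suml; apply: eq_bigr => j _; ring.
have -> : \sum_j c j * (chi k j * chi k (- a)) = char_sum k * chi k (- a).
  by rewrite mulr_suml; apply: eq_bigr => j _; rewrite mulrA.
(* For nonzero [k], [s k] squares to 1, so swapping [chi k a] and [chi k (- a)] multiplies the
   column by [s k]; column 0 is constantly 1. *)
rewrite /d /s; case: eqVneq => [->|k0]; last by case: leqP => _; ring.
by rewrite leq0n /chi !mul0n; ring.
Qed.

Let fourier := \matrix_(a, k < N.+1) chi a k.
Let T := \matrix_(b, k < N.+1) ((b == k)%:R + s k * (b == - k)%:R).

(** A Vandermonde matrix whose nodes, the powers of [z], are distinct because [z] is primitive. *)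
Let fourier_unit : fourier \in unitmx.
Proof.
have -> : fourier = Vandermonde N.+1 (\row_(j < N.+1) z ^+ j).
  by apply/matrixP=> a k; rewrite !mxE -exprM mulnC.
rewrite unitmxE unitfE det_Vandermonde.
apply/prodf_neq0 => i _; apply/prodf_neq0 => j ij; rewrite !mxE subr_eq0.
by rewrite (eq_prim_root_expr zP) !modn_small // gtn_eqF.
Qed.

Let sum_delta k (f : 'I_N.+1 -> C) : \sum_j (k == j)%:R * f j = f k.
Proof.
rewrite (bigD1 k) //= eqxx mul1r big1 ?addr0 // => j jk.
by rewrite eq_sym (negPf jk) mul0r.
Qed.

(* T expresses V in the basis of characters; as s is odd, its rows are
   orthogonal. *)
Let T_unit : T \in unitmx.
Proof.
have TT : T *m T^T = diag_mx (\row_k (1 + s k ^+ 2)).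
  apply/matrixP=> a b; rewrite !mxE.
  transitivity (\sum_k ((a == k)%:R * ((b == k)%:R + s k * (b == - k)%:R) +
      (- a == k)%:R * (s k * ((b == k)%:R + s k * (b == - k)%:R)))).
    by apply: eq_bigr => k _; rewrite !mxE -[a == - k]eqr_oppLR; ring.
  rewrite big_split /= !sum_delta sN opprK [b == a]eq_sym.
  by case: eqP => _; ring.
(* The values are 1 and 2, both nonzero in characteristic 0. *)
have s1 k : 1 + s k ^+ 2 != 0.
  rewrite /s; case: ifP => _; first by rewrite expr0n addr0 oner_eq0.
  by case: ifP => _; rewrite ?sqrrN expr1n -(natrD _ 1 1) pnatr_eq0.
have /mulmx1_unit[] : T *m (T^T *m diag_mx (\row_k (1 + s k ^+ 2)^-1)) = 1%:M.
  rewrite mulmxA TT mulmx_diag; apply/matrixP=> a b; rewrite !mxE.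
  by rewrite divff.
by [].
Qed.

Let V_unit : V \in unitmx.
Proof.
have -> : V = fourier *m T; last by rewrite unitmx_mul fourier_unit T_unit.
apply/matrixP=> a k; rewrite !mxE.
transitivity (\sum_j ((k == j)%:R * chi a j + (- k == j)%:R * (s k * chi a j))).
  rewrite big_split /= !sum_delta; congr (_ + _ * _); first exact: chiC.
  exact: chiN.
apply: eq_bigr => j _; rewrite !mxE [k == j]eq_sym [- k == j]eq_sym; ring.
Qed.

Lemma det_anticirculant :
  \det (\matrix_(a, b < N.+1) ('X *+ (a == b) - (c (a + b))%:P)) =
  ('X - (char_sum 0)%:P) *
    \prod_(1 <= r < N./2.+1) ('X^2 - (char_sum r ^+ 2)%:P).
Proof.
have -> : \matrix_(a, b < N.+1) ('X *+ (a == b) - (c (a + b))%:P) =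
    char_poly_mx A.
  by apply/matrixP=> a b; rewrite !mxE.
have -> : \det (char_poly_mx A) = char_poly (diag_mx (\row_k d k)).
  pose VP := map_mx polyC V.
  have VP0 : \det VP != 0.
    by rewrite det_map_mx polyC_eq0 -unitfE -unitmxE.
  (* Cancelling [\det VP] replaces conjugation by [V]; only [AV] is then needed. *)
  apply: (mulIf VP0); rewrite -det_mulmx [RHS]mulrC -det_mulmx.
  rewrite /char_poly_mx mulmxBl mulmxBr -!map_mxM AV.
  by rewrite scalar_mxC.
rewrite char_poly_trig ?diag_mx_is_trig //.
pose D (r : nat) : {poly C} :=
  'X - (if (r <= N./2)%N then char_sum r else - char_sum r)%:P.
transitivity (\prod_(k < N.+1) D k).
  by apply: eq_bigr => k _; rewrite !mxE eqxx.
have NE : N = (N./2 + N./2)%N.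
  by rewrite addnn -[LHS]odd_double_half (negPf N_even).
rewrite -(big_mkord xpredT) big_ltn // [D 0%N]/D leq0n; congr (_ * _).
rewrite (@big_cat_nat _ _ _ N./2.+1) //=; last by lia.
have -> : \prod_(N./2.+1 <= r < N.+1) D r =
    \prod_(1 <= r < N./2.+1) D (r + N./2)%N.
  by rewrite -{1}[N./2.+1]add1n big_addn; congr (\big[_/_]_(_ <= _ < _) _); lia.
(* Reversal pairs [r] with [N.+1 - r], whose eigenvalue is [- char_sum r]. *)
rewrite [X in _ * X]big_nat_rev -big_split.
apply: eq_big_nat => r /andP[_ rN] /=.
have -> : (1 + N./2.+1 - r.+1 + N./2 = N.+1 - r)%N by lia.
rewrite /D -ltnS rN ifN; last by rewrite -ltnNge; lia.
by rewrite char_sum_sub; [rewrite polyCN !polyC_exp; ring | lia].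
Qed.

End AntiCirculant.

(** * Primitivity of the complex root of unity *)

Section RootOfUnity.
Variable R : realType.

Lemma cos_sin_exp (t : R) (k : nat) :
  (cos t +i* sin t) ^+ k = cos (k%:R * t) +i* sin (k%:R * t).
Proof.
elim: k => [|k IHk]; first by rewrite expr0 mul0r cos0 sin0.
rewrite exprS IHk -natr1 [in RHS]mulrDl mul1r addrC cosD sinD; simpc.
by rewrite [X in _ = _ +i* X]addrC.
Qed.

(** By the half-angle formula [cos t] is 1 minus twice the square of [sin (t / 2)], which is
    positive. *)
Lemma cos_lt1 (t : R) : 0 < t < 2 * pi -> cos t < 1.
Proof.
move=> /andP[t0 tpi]; have st : 0 < sin (t / 2) by apply: sin_gt0_pi; lra.
have -> : t = (t / 2) *+ 2 by rewrite -mulr_natr divfK ?pnatr_eq0.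
rewrite cos_mulr2n; have := cos2Dsin2 (t / 2); nra.
Qed.

(** If the order [m] of [w] were less than [n], the angle of its [m]-th power would lie strictly
    between 0 and a full turn, so its real part could not be 1. *)
Lemma w_prim (n : nat) : (0 < n)%N -> n.-primitive_root (w R n).
Proof.
move=> n0; have n0R : 0 < n%:R :> R by rewrite ltr0n.
have wX k : w R n ^+ k =
    cos (k%:R * (2 * pi / n%:R)) +i* sin (k%:R * (2 * pi / n%:R)).
  by rewrite wE cos_sin_exp.
have wn1 : w R n ^+ n = 1.
  by rewrite wX mulrC divfK ?gt_eqF // mulr_natl cos2pi sin2pi.
have [m m_prim mn] := prim_order_exists n0 wn1.
suff mE : m = n by move: m_prim; rewrite mE.
apply/eqP; rewrite eqn_leq (dvdn_leq n0 mn) leqNgt; apply/negP => lt_mn.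
have m0 := prim_order_gt0 m_prim.
have := prim_expr_order m_prim; rewrite wX => -[cos1 _].
have pi0 := pi_gt0 R.
suff: cos (m%:R * (2 * pi / n%:R) : R) < 1 by rewrite cos1 ltxx.
apply: cos_lt1.
rewrite mulr_gt0 ?ltr0n ?divr_gt0 ?mulr_gt0 //=.
by rewrite mulrCA gtr_pMr ?mulr_gt0 // ltr_pdivrMr // mul1r ltr_nat.
Qed.

End RootOfUnity.

(** * Application to the unitary addition Cayley graph *)

Lemma coprime_subl (j n : nat) : (j <= n)%N -> coprime (n - j) n = coprime j n.
Proof. by move=> jn; rewrite -{2 3}(subnK jn) /coprime gcdnDl gcdnDr gcdnC. Qed.

Theorem theorem4p4 (R : realType) (n : nat) (n_odd : odd n) :
  graph_char_poly R[i] (unitary_addition_Cayley_graph n) =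
    ('X - ((totient n)%:R)%:P) *
      \prod_(1 <= r < ((n - 1) %/ 2).+1) ('X^2 - (lambda R n r ^+ 2)%:P)
    + \sum_(i in U n)
        graph_char_poly R[i]
          (del_vertex (del_loops (X_A n) [set j in U n | (j < i)%N]) i).
Proof.
transitivity (graph_char_poly R[i] (del_loops (X_A n) (U n))).
  apply: eq_graph_char_poly => // a b /=.
  rewrite /unitary_addition_adj /del_loops_adj /= /mx_adj mxE unit_coprime.
  rewrite /coprime /= gcdn_modl; case: (eqVneq a b) => [<-|ab] /=.
    rewrite unit_coprime /coprime addnn -mul2n.
    (* As [n] is odd, every loop of [X_A n] sits at a unit and is deleted. *)
    have -> : (gcdn (2 * a) n == 1%N) = (gcdn a n == 1%N).
      by rewrite -![_ == _]/(coprime _ _) coprimeMl coprime2n n_odd.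
    by case: ifP.
  by rewrite andbT; case: ifP.
rewrite graph_char_poly_del_loops; last by move=> i iU; rewrite X_A_loop.
congr (_ + _).
case: n n_odd => // N /= N_even.
pose c (j : 'I_N.+1) : R[i] := (coprime j N.+1)%:R.
have cN j : c (- j) = c j.
  by rewrite /c /= coprime_modl coprime_subl // ltnW.
have lambdaE r : lambda R N.+1 r = char_sum (w R N.+1) c r.
  rewrite /lambda big_mkord big_mkcond /=; apply: eq_bigr => j _.
  by rewrite /c /coprime; case: ifP => _; rewrite (mul0r, mul1r).
rewrite subn1 divn2.
under eq_bigr => r _ do rewrite lambdaE.
(* At frequency 0 all powers are 1, so the sum counts the units. *)
have -> : (totient N.+1)%:R = char_sum (w R N.+1) c 0.
  rewrite totient_count_coprime big_mkord natr_sum; apply: eq_bigr => j _.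
  by rewrite mul0n mulr1 coprime_sym.
rewrite -(det_anticirculant (w_prim R (ltn0Sn N)) N_even cN).
rewrite (graph_char_polyE _ (@inj_id 'I_N.+1)); last first.
  by move=> a; rewrite inE; apply/codomP; exists a.
congr (\det _); apply/matrixP => a b; rewrite !mxE /= /mx_adj mxE /c.
by rewrite /= coprime_modl /coprime; case: ifP.
Qed.
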